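(* Let $\mathbb Y$ be a Banach space with $\dim\mathbb Y\ge2$, let $y\in\mathbb Y$ and let $\mathbb M\subset\mathbb Y$ be a closed subspace. Let $y_0\in\mathbb M$ be such that $\|y-y_0\|_{\mathbb Y}\le\|y-z_0\|_{\mathbb Y}$ for all $z_0\in\mathbb M$. Then $$\|y_0\|_{\mathbb Y}\le\bigl(1+C_{\mathrm{AO}}(\mathbb Y)\bigr)\|y\|_{\mathbb Y},$$ where $C_{\mathrm{AO}}(\mathbb Y)\in[0,1]$ is the asymmetric-orthogonality constant of $\mathbb Y$.
   Context: All spaces are real. For a normed space $\mathbb Y$, the duality mapping is $\mathcal J_{\mathbb Y}(y)=\{y^*\in\mathbb Y^*:\langle y^*,y\rangle=\|y\|_{\mathbb Y}^2=\|y^*\|_{\mathbb Y^*}^2\}$. Asymmetric-orthogonality constant (for $\dim\mathbb Y\ge2$): $$C_{\mathrm{AO}}(\mathbb Y):=\sup\left\{\frac{\langle z_0^*,z\rangle_{\mathbb Y^*,\mathbb Y}}{\|z\|_{\mathbb Y}\|z_0\|_{\mathbb Y}}:(z_0,z)\in\mathcal O_{\mathbb Y},\ z_0^*\in\mathcal J_{\mathbb Y}(z_0)\right\},$$ $\mathcal O_{\mathbb Y}:=\{(z_0,z)\in\mathbb Y\times\mathbb Y:\exists z^*\in\mathcal J_{\mathbb Y}(z)\text{ with }\langle z^*,z_0\rangle=0\}$ (the supremum being over nonzero $z_0,z$). *)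

(* Defs.v *)
From HB Require Import structures.
From mathcomp Require Import all_boot all_order all_algebra.
From mathcomp Require Import all_classical all_reals all_analysis.
Set Implicit Arguments.
Unset Strict Implicit.
Unset Printing Implicit Defensive.
Import Order.TTheory GRing.Theory Num.Theory.
Import numFieldNormedType.Exports.

Local Open Scope classical_set_scope.
Local Open Scope ring_scope.

Definition lin_indep (R : realType) (Y : normedModType R) (n : nat)
    (e : 'I_n -> Y) : Prop :=
  forall a : 'I_n -> R, \sum_(i < n) a i *: e i = 0 -> forall i, a i = 0.

(* dim Y >= n, also meaningful for infinite-dimensional Y *)
Definition dim_ge (R : realType) (Y : normedModType R) (n : nat) : Prop :=
  exists e : 'I_n -> Y, lin_indep e.

Definition dual (R : realType) (Y : normedModType R) : set {linear Y -> R^o} :=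
  [set f | continuous f].
Arguments dual {R} Y.

(* The supremum is over a nonempty set, which is bounded when f is in dual Y;
   only that case is used. *)
Definition dual_norm (R : realType) (Y : normedModType R)
    (f : {linear Y -> R^o}) : R :=
  sup [set `|f x : R| | x in [set x : Y | `|x| <= 1]].

Definition duality_map (R : realType) (Y : normedModType R) (y : Y) :
    set {linear Y -> R^o} :=
  [set f | [/\ dual Y f, (f y : R) = `|y| ^+ 2
             & `|y| ^+ 2 = dual_norm f ^+ 2]].

Definition AO_pairs (R : realType) (Y : normedModType R) : set (Y * Y) :=
  [set p | exists2 f, duality_map p.2 f & (f p.1 : R) = 0].
Arguments AO_pairs {R} Y.

(* Supremum in the extended reals, so that no default value is involved when
   the set of quotients is empty or unbounded. *)
Definition C_AO (R : realType) (Y : normedModType R) : \bar R :=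
  ereal_sup [set r : \bar R | exists (z0 z : Y) (f : {linear Y -> R^o}),
    [/\ z0 != 0, z != 0, AO_pairs Y (z0, z), duality_map z0 f
      & r = ((f z : R) / (`|z| * `|z0|))%:E]].

(* Main.v *)
(* By Hahn-Banach, (y, z) is in O_Y if and only if z is Birkhoff-James orthogonal
   to y, i.e. |z| <= |z + t y| for all t; in particular (y, -z) is then in O_Y too.
   The residual z = y - y0 of a best approximation is Birkhoff-James orthogonal to
   y0, so for any y0* in J(y0)
     |y0|^2 = <y0*, y> + <y0*, -z> <= |y0| |y| + C_AO |z| |y0|,
   and |z| <= |y| because 0 is in M.  The Hahn-Banach theorem comes from the fact
   that the minimal sublinear functionals are the linear ones. *)
Require Import Defs.
From HB Require Import structures.
From mathcomp Require Import all_boot all_order all_algebra.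
From mathcomp Require Import all_classical all_reals all_analysis.
From mathcomp Require Import lra.
Import Order.TTheory GRing.Theory Num.Theory.
Import numFieldNormedType.Exports.
Local Open Scope classical_set_scope.
Local Open Scope ring_scope.

(** * Sublinear functionals and the Hahn-Banach theorem *)

Definition sublinear {R : realType} {V : lmodType R} (p : V -> R) : Prop :=
  (forall x y, p (x + y) <= p x + p y) /\
  (forall t x, 0 <= t -> p (t *: x) <= t * p x).

Section Sublinear.
Context {R : realType} {V : lmodType R}.
Implicit Types p q : V -> R.

Lemma sublinear0 p : sublinear p -> p 0 = 0.
Proof.
move=> [pD pZ]; have := pD 0 0; have := pZ 0 0 (lexx 0).
by rewrite scale0r addr0 mul0r; lra.
Qed.

Lemma sublinearZ p t x : sublinear p -> 0 <= t -> p (t *: x) = t * p x.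
Proof.
move=> sp; rewrite le_eqVlt => /predU1P[<-|t0].
  by rewrite scale0r mul0r sublinear0.
apply/eqP; rewrite eq_le (sp.2 _ _ (ltW t0)) /= mulrC -ler_pdivlMr // mulrC.
rewrite -[in leLHS](scalerK (lt0r_neq0 t0) x).
by apply: sp.2; rewrite invr_ge0 ltW.
Qed.

Lemma sublinearN_ge p x : sublinear p -> - p (- x) <= p x.
Proof.
move=> sp; have := sp.1 x (- x); rewrite subrr sublinear0 //; lra.
Qed.

(** Serves both infimal convolutions and infima of chains: the index [k] may depend on the points.
    The minorant [b] keeps each [inf] a genuine infimum instead of a default value. *)
Lemma sublinear_inf (I : Type) (D : set I) (F : I -> V -> R) (b : V -> R) :
  D !=set0 ->
  (forall i x, D i -> b x <= F i x) ->
  (forall i j x y, D i -> D j ->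
     exists2 k, D k & F k (x + y) <= F i x + F j y) ->
  (forall i t x, D i -> 0 <= t -> exists2 k, D k & F k (t *: x) <= t * F i x) ->
  let q := fun x => inf [set F i x | i in D] in
  sublinear q /\ forall i x, D i -> q x <= F i x.
Proof.
move=> [i0 Di0] bF FD FZ q.
have qF i x : D i -> q x <= F i x.
  move=> Di; apply: ge_inf; last by exists i.
  by exists (b x) => _ [j Dj <-]; exact: bF.
have Fq x a : (forall i, D i -> a <= F i x) -> a <= q x.
  move=> aF; apply: lb_le_inf; first by exists (F i0 x); exists i0.
  by move=> _ [i Di <-]; exact: aF.
split=> //; split=> [x y|t x t0].
  rewrite -lerBlDr; apply: (Fq) => i Di.
  rewrite lerBlDr [leRHS]addrC -lerBlDr; apply: (Fq) => j Dj.
  rewrite lerBlDr [leRHS]addrC; have [k Dk /(le_trans _)->//] := FD i j x y Di Dj.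
  exact: qF.
have [->|tN0] := eqVneq t 0.
  have [k Dk] := FZ i0 0 x Di0 (lexx 0); rewrite !mul0r.
  by apply: le_trans; exact: qF.
have t_gt0 : 0 < t by rewrite lt_neqAle eq_sym tN0.
rewrite mulrC -ler_pdivrMr //; apply: (Fq) => i Di.
rewrite ler_pdivrMr // mulrC; have [k Dk /(le_trans _)->//] := FZ i t x Di t0.
exact: qF.
Qed.

(* Replacing [p] by its infimal convolution with the cone [K] forces a linear
   minorant of the result to dominate [c] at [k] whenever [(k, c)] is in [K]. *)
Lemma sublinear_cone (K : set (V * R)) p :
  sublinear p -> K !=set0 ->
  (forall k l, K k -> K l -> K (k.1 + l.1, k.2 + l.2)) ->
  (forall t k, 0 <= t -> K k -> K (t *: k.1, t * k.2)) ->
  (forall k, K k -> k.2 <= p k.1) ->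
  exists q, [/\ sublinear q, forall x, q x <= p x
              & forall k, K k -> q (- k.1) <= - k.2].
Proof.
move=> sp K0 KD KZ Kp.
have [||k l x y Kk Kl|k t x Kk t0|sq qF] :=
    @sublinear_inf _ K (fun k x => p (x + k.1) - k.2) (fun x => - p (- x)).
- exact: K0.
- move=> k x Kk; have := sp.1 (x + k.1) (- x); have := Kp k Kk.
  by rewrite addrAC subrr add0r; lra.
- exists (k.1 + l.1, k.2 + l.2); first exact: KD.
  by have /= := sp.1 (x + k.1) (y + l.1); rewrite addrACA; lra.
- exists (t *: k.1, t * k.2); first exact: KZ.
  by have /= := sp.2 t (x + k.1) t0; rewrite scalerDr; lra.
have [k0 Kk0] := K0.
exists (fun x => inf [set p (x + k.1) - k.2 | k in K]); split=> // [x|k Kk].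
  (* The index [(0, 0)], a multiple of [k0], gives [q <= p]; the index [k] itself gives the bound at
     [- k.1]. *)
  by have := qF _ x (KZ 0 _ (lexx 0) Kk0); rewrite /= scale0r mul0r addr0 subr0.
by have := qF k (- k.1) Kk; rewrite /= addNr sublinear0// sub0r.
Qed.

(** Zorn's lemma for the reversed pointwise order: the infimum of a nonempty chain is again
    sublinear, since all its members stay above [- p (- x)]. *)
Lemma sublinear_minimal p : sublinear p ->
  exists q, [/\ sublinear q, forall x, q x <= p x &
    forall r, sublinear r -> (forall x, r x <= q x) -> r = q].
Proof.
move=> sp; pose T := {q | sublinear q /\ forall x, q x <= p x}.
pose ge (r s : T) := `[< forall x, sval s x <= sval r x >].
have [||||[m [sm mp]] minm] := @Zorn T ge.
- by move=> q; apply/asboolP.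
- by move=> q r s /asboolP qr /asboolP rs; apply/asboolP => x; apply: le_trans (qr x).
- move=> [q sq] [r sr] /asboolP /= qr /asboolP /= rq; apply: eq_exist.
  by apply/funext => x; apply/eqP; rewrite eq_le rq qr.
- move=> A totA; have [->|/set0P[q0 Aq0]] := eqVneq A set0.
    by exists (exist _ p (conj sp (fun=> lexx _))).
  have [||q r x y Aq Ar|q t x Aq t0|si iA] :=
    @sublinear_inf T A (fun r => sval r) (fun x => - p (- x)).
  + by exists q0.
  + move=> [q [sq qp]] x _ /=.
    by apply: le_trans (sublinearN_ge _ _ sq); rewrite lerN2.
  + have [/asboolP qr|/asboolP rq] := totA _ _ Aq Ar.
      exists r => //; apply: le_trans ((svalP r).1.1 x y) _.
      by rewrite lerD2r.
    exists q => //; apply: le_trans ((svalP q).1.1 x y) _.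
    by rewrite lerD2l.
  + by exists q => //; exact: (svalP q).1.2.
  have ip x : inf [set sval r x | r in A] <= p x.
    by apply: le_trans (iA q0 x Aq0) _; exact: (svalP q0).2.
  exists (exist (fun q => sublinear q /\ forall x, q x <= p x) _ (conj si ip)).
  by move=> q Aq; apply/asboolP => x; exact: iA.
exists m; split=> // r sr rm.
have rp x : r x <= p x by apply: le_trans (rm x) (mp x).
suff /(congr1 sval) : exist _ r (conj sr rp) = exist _ m (conj sm mp) :> T by [].
by apply: minm; apply/asboolP.
Qed.

(** A minimal sublinear [m] below the functional [q] of [sublinear_cone] is odd, hence linear, and
    [- m k.1 = m (- k.1) <= q (- k.1) <= - k.2]. *)
Lemma hahn_banach_cone (K : set (V * R)) p :
  sublinear p -> K !=set0 ->
  (forall k l, K k -> K l -> K (k.1 + l.1, k.2 + l.2)) ->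
  (forall t k, 0 <= t -> K k -> K (t *: k.1, t * k.2)) ->
  (forall k, K k -> k.2 <= p k.1) ->
  exists f : {linear V -> R^o},
    (forall x, (f x : R) <= p x) /\ (forall k, K k -> k.2 <= (f k.1 : R)).
Proof.
move=> sp K0 KD KZ Kp.
have [q [sq qp qK]] := sublinear_cone K p sp K0 KD KZ Kp.
have [m [sm mq minm]] := sublinear_minimal q sq.
(* Minimality applied to the cone of the nonnegative multiples of [(x, m x)]. *)
have mN x : m (- x) = - m x.
  apply/eqP; rewrite eq_le; apply/andP; split; last first.
    by have := sublinearN_ge m x sm; rewrite lerNl.
  have [|||k [t t0 <-]|r [sr rm rK]] :=
    @sublinear_cone [set (t *: x, t * m x) | t in [set t : R | 0 <= t]] m sm.
  - by exists (0 *: x, 0 * m x); exists 0 => //=.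
  - move=> _ _ [s s0 <-] [t t0 <-]; exists (s + t); first exact: addr_ge0.
    by rewrite scalerDl mulrDl.
  - move=> t _ t0 [s s0 <-]; exists (t * s); first exact: mulr_ge0.
    by rewrite scalerA mulrA.
  - by rewrite /= sublinearZ.
  rewrite -[in leLHS](minm r sr rm).
  by have := rK (x, m x); apply; exists 1; rewrite ?scale1r ?mul1r //=.
have mD x y : m (x + y) = m x + m y.
  apply/eqP; rewrite eq_le sm.1 /=.
  (* Oddness turns subadditivity at [- x], [- y] into superadditivity at [x], [y]. *)
  have := sm.1 (- x) (- y); rewrite -opprD !mN; lra.
have mZ t x : m (t *: x) = t * m x.
  have [t0|/ltW t0] := leP 0 t; first exact: sublinearZ.
  apply: oppr_inj; rewrite -mN -scaleNr -mulNr.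
  by rewrite sublinearZ // oppr_ge0.
have mlin : linear (m : V -> R^o) by move=> t x y; rewrite mD mZ.
pose f : {linear V -> R^o} := HB.pack (m : V -> R^o)
  (GRing.isLinear.Build R V R^o *:%R (m : V -> R^o) mlin).
exists f; split=> [x|k Kk]; first exact: le_trans (mq x) (qp x).
have := le_trans (mq _) (qK k Kk); rewrite mN lerN2; exact.
Qed.

End Sublinear.

(** * The duality map, Birkhoff-James orthogonality and the bounds on [C_AO] *)

Section DualityMap.
Context {R : realType} {Y : normedModType R}.
Implicit Types (x y z : Y) (f : {linear Y -> R^o}).

Lemma functionalZ f (a : R) x : (f (a *: x) : R) = a * (f x : R).
Proof. by rewrite linearZ. Qed.

(** The one-sided bound controls [|f x|] because [f] is odd; for nonzero [z] the dual norm is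
    attained at [z / |z|]. *)
Lemma bounded_duality_map z f :
  (forall x, (f x : R) <= `|z| * `|x|) -> (f z : R) = `|z| ^+ 2 ->
  duality_map z f.
Proof.
move=> fle fz.
have fabs x : `|f x : R| <= `|z| * `|x|.
  by rewrite ler_norml fle andbT lerNl -linearN -(normrN x) fle.
have df : dual Y f.
  apply: bounded_linear_continuous; apply/linear_boundedP.
  exists `|z|; split=> [|r zr x]; first exact: num_real.
  by apply: le_trans (fabs x) _; rewrite ler_wpM2r // ltW.
have has : has_sup [set `|f x : R| | x in [set x : Y | `|x| <= 1]].
  split; first by exists `|f 0 : R|; exists 0 => //=; rewrite normr0.
  exists `|z| => _ [x /= x1 <-]; apply: le_trans (fabs x) _.
  by rewrite ler_piMr.
split=> //; congr (_ ^+ 2); apply/eqP; rewrite eq_le; apply/andP; split.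
  have [->|z0] := eqVneq z 0.
    rewrite normr0; apply: le_trans (normr_ge0 (f 0 : R)) _.
    by apply: sup_upper_bound => //; exists 0 => //=; rewrite normr0.
  have zz : `|z| != 0 by rewrite normr_eq0.
  apply: sup_upper_bound => //; exists (`|z|^-1 *: z).
    by rewrite /= normrZ normfV normr_id mulVf.
  rewrite functionalZ fz expr2 mulKf //.
  by rewrite normr_id.
apply: ge_sup; first exact: has.1.
move=> _ [x /= x1 <-]; apply: le_trans (fabs x) _.
by rewrite ler_piMr.
Qed.

Lemma duality_map_le z f x : duality_map z f -> (f x : R) <= `|z| * `|x|.
Proof.
move=> [df fz fn].
have hub : has_ubound [set `|f x : R| | x in [set x : Y | `|x| <= 1]].
  have /linear_bounded_continuous/bounded_funP/(_ 1)[B fB] := df.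
  by exists B => _ [w /= w1 <-]; exact: fB.
(* Nonnegativity lets the squares in the definition of [duality_map] be cancelled. *)
have dn0 : 0 <= dual_norm f.
  apply: le_trans (normr_ge0 (f 0 : R)) _.
  by apply: ub_le_sup => //; exists 0 => //=; rewrite normr0.
move/eqP : fn; rewrite eqrXn2 // => /eqP ->.
have [->|x0] := eqVneq x 0; first by rewrite linear0 normr0 mulr0.
have xx : 0 < `|x| by rewrite normr_gt0.
rewrite -ler_pdivrMr //; apply: le_trans (ler_norm _) _.
apply: ub_le_sup => //; exists (`|x|^-1 *: x).
  by rewrite /= normrZ normfV normr_id mulVf // gt_eqF.
by rewrite functionalZ mulrC.
Qed.

Lemma AO_pairsP y z :
  AO_pairs Y (y, z) <-> forall t : R, `|z| <= `|z + t *: y|.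
Proof.
split=> [[f /= Jf fy] t|zy].
  have [->|z0] := eqVneq z 0; first by rewrite normr0.
  have [_ fz _] := Jf; have := duality_map_le z f (z + t *: y) Jf.
  by rewrite linearD functionalZ fy mulr0 addr0 fz expr2 ler_pM2l ?normr_gt0.
(* The generator [(z, |z|^2)] will force [f z >= |z|^2], and the whole line of the [(t *: y, 0)]
   will force [f y = 0]. *)
pose K := [set ((s.1 *: z + s.2 *: y : Y), s.1 * `|z| ^+ 2) |
  s in [set s : R * R | 0 <= s.1]].
have [||||k [[s t] /= s0 <-]|f [fle fK]] :=
    @hahn_banach_cone _ _ K (fun x => `|z| * `|x|).
- split=> [x w|t x t0]; first by rewrite -mulrDr ler_wpM2l // ler_normD.
  by rewrite normrZ ger0_norm // mulrCA.
- by eexists; exists (0, 0) => /=.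
- move=> _ _ [s s0 <-] [t t0 <-]; exists (s + t); first exact: addr_ge0.
  by rewrite /= !scalerDl mulrDl addrACA.
- move=> a _ a0 [s s0 <-]; exists (a * s.1, a * s.2); first exact: mulr_ge0.
  by rewrite /= scalerDr !scalerA -mulrA.
- rewrite /= expr2 mulrCA ler_wpM2l //.
  (* For [s > 0], this is the orthogonality hypothesis at [t / s], scaled by [s]. *)
  have [->|sN0] := eqVneq s 0; first by rewrite mul0r.
  have -> : s *: z + t *: y = s *: (z + (s^-1 * t) *: y).
    by rewrite scalerDr scalerA mulVKf.
  by rewrite normrZ ger0_norm // ler_wpM2l.
have Ky t : (0 : R) <= f (t *: y).
  have := fK (t *: y, 0); apply; exists (0, t) => //=.
  by rewrite scale0r add0r mul0r.
exists f.
  apply: bounded_duality_map => //; apply/eqP; rewrite eq_le {1}expr2 fle /=.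
  have := fK (z, `|z| ^+ 2); apply; exists (1, 0) => //=.
  by rewrite scale1r scale0r addr0 mul1r.
apply/eqP; rewrite eq_le; have := Ky 1; have := Ky (- 1).
by rewrite scaleN1r scale1r linearN oppr_ge0 => -> ->.
Qed.

Lemma AO_pairsNr y z : AO_pairs Y (y, z) -> AO_pairs Y (y, - z).
Proof.
move=> /AO_pairsP zy; apply/AO_pairsP => t.
by rewrite normrN -[leRHS]normrN opprD opprK -scaleNr.
Qed.

(** Every [z] is Birkhoff-James orthogonal to [0], and the functional witnessing this is the one
    sought. *)
Lemma duality_map_nonempty z : duality_map z !=set0.
Proof.
have /AO_pairsP[f Jf _] : forall t : R, `|z| <= `|z + t *: 0|.
  by move=> t; rewrite scaler0 addr0.
by exists f.
Qed.

Lemma C_AO_le1 : (C_AO Y <= 1)%E.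
Proof.
apply: ge_ereal_sup => _ [z0 [z [f [z00 zN0 _ Jf ->]]]].
rewrite lee_fin ler_pdivrMr ?mulr_gt0 ?normr_gt0 // mul1r mulrC.
exact: duality_map_le.
Qed.

Lemma C_AO_ge z0 z f : z0 != 0 -> z != 0 -> AO_pairs Y (z0, z) ->
  duality_map z0 f -> (((f z : R) / (`|z| * `|z0|))%:E <= C_AO Y)%E.
Proof. by move=> *; apply: ereal_sup_ubound; exists z0, z, f. Qed.

(** One orthogonal pair of nonzero vectors suffices, since flipping the sign of its second entry
    makes the quotient nonnegative. *)
Lemma C_AO_ge0 : dim_ge Y 2 -> (0 <= C_AO Y)%E.
Proof.
move=> [e indep_e]; pose z := e ord0.
have comb (a b : R) : a *: e ord0 + b *: e ord_max = 0 -> a = 0 /\ b = 0.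
  move=> ab0; pose c (i : 'I_2) := if i == ord0 then a else b.
  have /indep_e c0 : \sum_(i < 2) c i *: e i = 0.
    rewrite big_ord_recl big_ord1 -[RHS]ab0.
    by congr (_ + c _ *: e _); apply/val_inj.
  by split; [have := c0 ord0 | have := c0 ord_max].
have zN0 : z != 0.
  apply/eqP => z0; have [|/eqP] := comb 1 0; last by rewrite oner_eq0.
  by rewrite -/z z0 scaler0 scale0r addr0.
have [f Jf] := duality_map_nonempty z; have [_ fz _] := Jf.
(* [w] is the projection of [e ord_max] onto the kernel of [f] along [z]; the explicit coefficient
   [1] lets [comb] show that it is nonzero. *)
pose w := - ((f (e ord_max) : R) / `|z| ^+ 2) *: z + 1 *: e ord_max.
have wN0 : w != 0.
  by apply/eqP => /comb[_ /eqP]; rewrite oner_eq0.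
have zw : AO_pairs Y (w, z).
  exists f => //=; rewrite linearD !functionalZ fz mul1r mulNr divfK ?addNr //.
  by rewrite expf_neq0 // normr_eq0.
have [g Jg] := duality_map_nonempty w.
have [gz|gz] := leP 0 (g z : R).
  apply: le_trans (C_AO_ge w z g wN0 zN0 zw Jg).
  by rewrite lee_fin divr_ge0 // mulr_ge0.
apply: le_trans (C_AO_ge w (- z) g wN0 _ (AO_pairsNr w z zw) Jg); last first.
  by rewrite oppr_eq0.
by rewrite lee_fin linearN divr_ge0 ?mulr_ge0 // oppr_ge0 ltW.
Qed.

End DualityMap.

(** * The norm of a best approximation *)

Theorem proposition2p19 (R : realType) (Y : completeNormedModType R)
    (dimY : dim_ge Y 2) (y : Y) (M : set Y)
    (subM : submod_closed (mem M)) (closedM : closed M)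
    (y0 : Y) (My0 : M y0)
    (best : forall z0 : Y, M z0 -> `|y - y0| <= `|y - z0|) :
  (0 <= C_AO Y <= 1)%E /\
  (`|y0|%:E <= (1 + C_AO Y) * `|y|%:E)%E.
Proof.
have C0 := C_AO_ge0 dimY; have C1 := @C_AO_le1 R Y.
split; first by rewrite C0 C1.
have /fineK Cfin : C_AO Y \is a fin_num.
  by rewrite ge0_fin_numE // (le_lt_trans C1) // ltry.
set c := fine _ in Cfin.
rewrite -Cfin -EFinD -EFinM lee_fin.
have c0 : 0 <= c by rewrite -lee_fin Cfin.
(* The supremum ranges over nonzero vectors, so [y0 = 0] and [y = y0] are treated apart. *)
have [->|y0N0] := eqVneq y0 0; first by rewrite normr0 mulr_ge0 // addr_ge0.
have [/eqP|zN0] := eqVneq (y - y0) 0.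
  by rewrite subr_eq0 => /eqP ->; rewrite ler_peMl // lerDl.
have [M0 MZD] := subM.
have MZ (a : R) : M (a *: y0).
  by have := MZD a y0 0; rewrite addr0 !inE => /(_ My0); apply; rewrite -inE.
have y0z : AO_pairs Y (y0, y - y0).
  (* The competitor [(1 - t) *: y0] has residual [(y - y0) + t *: y0]. *)
  apply/AO_pairsP => t; have := best _ (MZ (1 - t)).
  by rewrite scalerBl scale1r opprB addrCA addrC addrAC.
have [f Jf] := duality_map_nonempty y0; have [_ fy0 _] := Jf.
(* The opposite residual is used because [f (- (y - y0)) = |y0|^2 - f y]. *)
have := @C_AO_ge R Y y0 (- (y - y0)) f y0N0 _ (AO_pairsNr _ _ y0z) Jf.
rewrite oppr_eq0 => /(_ zN0); rewrite normrN -Cfin lee_fin.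
rewrite ler_pdivrMr ?mulr_gt0 ?normr_gt0 // linearN linearB fy0 opprB => cz.
have zy : `|y - y0| <= `|y|.
  have := best 0; rewrite subr0; apply.
  by have := MZ 0; rewrite scale0r.
have fy := duality_map_le y0 f y Jf.
(* After multiplication by [|y0|], the goal follows by adding [fy] and [cz], with [|y - y0|] bounded
   by [|y|]. *)
rewrite -(ler_pM2l (_ : 0 < `|y0|)) ?normr_gt0 // -expr2.
have : c * (`|y - y0| * `|y0|) <= `|y0| * (c * `|y|).
  by rewrite [leRHS]mulrCA ler_wpM2l // mulrC ler_wpM2l.
by rewrite mulrDl mulrDr mul1r; lra.
Qed.
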